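(* Let $\mathrm{Re}(\ell)\ge0$. For every $n\in\mathbb{N}_0$, $$[n]_{\ell}! = (n!)^{\ell n+1}.$$
   Context: $\mathbb{N}_0$ is the set of non-negative integers. For $n\in\mathbb{N}$ and $\ell\in\mathbb{C}$ with $\mathrm{Re}(\ell)\ge0$, the $\ell$-analogue of $n$ is $[n]_{\ell}=n^{\ell n+1}((n-1)!)^{\ell}=\dfrac{(n!)^{\ell n+1}}{((n-1)!)^{\ell n-\ell+1}}$, and $[0]_\ell=0$. The $\ell$-factorial is $[k]_{\ell}!=[k]_{\ell}[k-1]_{\ell}\cdots[2]_{\ell}[1]_{\ell}$ for $k\ge1$, with $[0]_{\ell}!=1$. *)

(* Defs.v *)
From Stdlib Require Export Factorial Reals.
From Coquelicot Require Export Coquelicot.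

Open Scope C_scope.

Definition Cexp (z : C) : C :=
  exp (Re z) * (cos (Im z) + Ci * sin (Im z)).

(* Complex power [x ^ z = exp (z ln x)] with the real logarithm.  It is
   meaningful only for [0 < x], Stdlib's [ln] being [0] elsewhere; below the
   bases are positive integers. *)
Definition Cpower (x : R) (z : C) : C := Cexp (z * ln x).

(* At [n = S m], the factor [fact m] is [(n - 1)!]. *)
Definition ell_number (l : C) (n : nat) : C :=
  match n with
  | O => 0
  | S m => Cpower (INR n) (l * INR n + 1) * Cpower (INR (fact m)) l
  end.

Fixpoint ell_factorial (l : C) (k : nat) : C :=
  match k with
  | O => 1
  | S j => ell_number l k * ell_factorial l j
  end.

(* Main.v *)
Require Import Defs.

(** Induction on $n$. The factor $[n+1]_\ell=(n+1)^{\ell(n+1)+1}(n!)^\ell$ brings just the power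
    $(n!)^\ell$ that lifts $(n!)^{\ell n+1}$ to the exponent $\ell(n+1)+1$ already carried by $n+1$.
    With equal exponents the bases multiply to $(n+1)!$. The two power laws used, [Cpower_plus] and
    [Cpower_mult_distr], both come from [Cexp_plus]. *)

Lemma Cexp_plus (z w : C) : Cexp (z + w) = Cexp z * Cexp w.
Proof.
unfold Cexp.
replace (Re (z + w)) with (Re z + Re w)%R by reflexivity.
replace (Im (z + w)) with (Im z + Im w)%R by reflexivity.
rewrite exp_plus, cos_plus, sin_plus.
apply injective_projections; simpl; ring.
Qed.

Lemma Cexp_0 : Cexp 0 = 1.
Proof.
unfold Cexp; simpl; rewrite exp_0, cos_0, sin_0.
apply injective_projections; simpl; ring.
Qed.

Lemma Cpower_1_l (z : C) : Cpower 1 z = 1.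
Proof. unfold Cpower; rewrite ln_1, Cmult_0_r; exact Cexp_0. Qed.

Lemma Cpower_plus (x : R) (z w : C) :
  Cpower x (z + w) = Cpower x z * Cpower x w.
Proof. unfold Cpower; rewrite Cmult_plus_distr_r; apply Cexp_plus. Qed.

(** Positivity gives $\ln(xy)=\ln x+\ln y$ for the real logarithm, so no branch correction
    arises. *)
Lemma Cpower_mult_distr (x y : R) (z : C) :
  (0 < x)%R -> (0 < y)%R -> Cpower (x * y) z = Cpower x z * Cpower y z.
Proof.
intros Hx Hy; unfold Cpower.
rewrite ln_mult, RtoC_plus, Cmult_plus_distr_l by assumption.
apply Cexp_plus.
Qed.

Theorem mainTheorem5 (l : C) (hl : (0 <= Re l)%R) (n : nat) :
  ell_factorial l n = Cpower (INR (fact n)) (l * INR n + 1).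
Proof.
induction n as [|n IH].
(* [INR (fact 0)] computes to 1. *)
- symmetry; apply Cpower_1_l.
- change (ell_factorial l (S n))
    with (Cpower (INR (S n)) (l * INR (S n) + 1) * Cpower (INR (fact n)) l
          * ell_factorial l n).
  (* On the left the two powers of $n!$ merge; on the right $(n+1)!$ becomes $(n+1)\,n!$, ready to
     be split. *)
  rewrite IH, <- Cmult_assoc, <- Cpower_plus, fact_simpl, mult_INR.
  rewrite Cpower_mult_distr
    by (apply lt_0_INR; first [apply Nat.lt_0_succ | apply lt_O_fact]).
  replace (l + (l * INR n + 1)) with (l * INR (S n) + 1)
    by (rewrite S_INR, RtoC_plus; ring).
  reflexivity.
Qed.
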